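(* Let $$L_{\mathcal{DT}}=\{(x_1,x_2,x_3)\in\mathbb{Z}^3 \mid x_1+x_2,\ x_2+x_3,\ x_3+x_1 \text{ are even}\}$$ and $$L_{\mathcal{D}}=\{(x_1,x_2,x_3)\in\mathbb{Z}^3 \mid x_1+x_2+x_3 \text{ is even}\}.$$ Up to similarity, the three lattices $\mathbb{Z}^3$, $L_{\mathcal{DT}}$ and $L_{\mathcal{D}}$ are the only orthogonally symmetric lattices in $\mathbb{R}^3$. That is, a lattice $L\subset\mathbb{R}^3$ is orthogonally symmetric if and only if there exist a real number $c>0$ and $g\in \mathrm{O}(3)$ such that $c\,g(L)$ is one of $\mathbb{Z}^3$, $L_{\mathcal{DT}}$, $L_{\mathcal{D}}$.
   Context: A lattice in $\mathbb{R}^d$ is a discrete additive subgroup of $\mathbb{R}^d$ of maximal rank, i.e. the set of integer linear combinations of some basis of $\mathbb{R}^d$. Here $\mathbb{R}^d$ carries the standard Euclidean norm $\|\cdot\|$, and $\mathrm{O}(d)$ is its orthogonal group. For a lattice $L\subset\mathbb{R}^d$ put $$\alpha(L)=\min_{\mathbf{y}\in L,\ \mathbf{y}\neq \mathbf{0}}\|\mathbf{y}\|,\qquad K(L)=\{\mathbf{x}\in L \mid \|\mathbf{x}\|=\alpha(L)\},\qquad G(L)=\{g\in \mathrm{O}(d)\mid g(L)=L\}.$$ A lattice $L$ in $\mathbb{R}^d$ is called orthogonally symmetric if: (i) $K(L)$ generates $L$ (as an additive group); (ii) $G(L)$ acts transitively on $K(L)$; and (iii) the action of $G(L)$ on $\mathbb{R}^d$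 is irreducible, i.e. the only $G(L)$-invariant real linear subspaces of $\mathbb{R}^d$ are $\{\mathbf{0}\}$ and $\mathbb{R}^d$. *)

(* Defs.v *)
From mathcomp Require Import all_boot all_order all_algebra.
From mathcomp Require Import classical_sets reals.

Set Implicit Arguments.
Unset Strict Implicit.
Unset Printing Implicit Defensive.

Import Order.TTheory GRing.Theory Num.Theory.

Local Open Scope classical_set_scope.
Local Open Scope ring_scope.

Section Lattices.
Variables (R : realType) (d : nat).
Implicit Types (x y : 'cV[R]_d) (g : 'M[R]_d) (L A : set 'cV[R]_d).

Definition enorm x : R := Num.sqrt (\sum_(i < d) x i 0 ^+ 2).

Definition orthogonal_group : set 'M[R]_d := [set g | g *m g^T = 1%:M].

Definition is_lattice L : Prop :=
  exists2 b : d.-tuple 'cV[R]_d, basis_of fullv b &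
    L = [set \sum_(i < d) tnth b i *~ z i | z in [set: 'I_d -> int]].

(* The infimum is attained, hence a minimum, when L is a lattice and d > 0. *)
Definition min_norm L : R := inf [set enorm y | y in L `\ 0].

Definition min_vectors L : set 'cV[R]_d :=
  [set x | L x /\ enorm x = min_norm L].

Definition symmetry_group L : set 'M[R]_d :=
  [set g | orthogonal_group g /\ mulmx g @` L = L].

Definition additive_subgroup A : Prop :=
  A 0 /\ forall x y, A x -> A y -> A (x - y).

Definition generates A L : Prop := smallest additive_subgroup A = L.

Definition transitive_on (G : set 'M[R]_d) A : Prop :=
  forall x y, A x -> A y -> exists2 g, G g & g *m x = y.

Definition irreducible_action (G : set 'M[R]_d) : Prop :=
  forall V : {vspace 'cV[R]_d},
    (forall g, G g -> forall x, x \in V -> g *m x \in V) ->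
    V = 0%VS \/ V = fullv.

Definition orthogonally_symmetric L : Prop :=
  [/\ is_lattice L,
      generates (min_vectors L) L,
      transitive_on (symmetry_group L) (min_vectors L) &
      irreducible_action (symmetry_group L)].

End Lattices.

Section CubicLattices.
Variable R : realType.

(* Coordinates x_1, x_2, x_3 are the entries 0, 1, 2 of a column vector. *)
Definition lattice_Z3 : set 'cV[R]_3 :=
  [set map_mx intr z | z in [set: 'cV[int]_3]].

Definition lattice_DT : set 'cV[R]_3 :=
  [set map_mx intr z | z in [set z : 'cV[int]_3 |
    [/\ (2 %| (z 0 0 + z 1 0)%R)%Z, (2 %| (z 1 0 + z 2 0)%R)%Z
      & (2 %| (z 2 0 + z 0 0)%R)%Z]]].

Definition lattice_D : set 'cV[R]_3 :=
  [set map_mx intr z | z in [set z : 'cV[int]_3 |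
    (2 %| (z 0 0 + z 1 0 + z 2 0)%R)%Z]].

End CubicLattices.

Arguments lattice_Z3 R : clear implicits.
Arguments lattice_DT R : clear implicits.
Arguments lattice_D R : clear implicits.

(* Main.v *)
Require Import Defs.
From mathcomp Require Import all_boot all_order all_algebra all_fingroup.
From mathcomp Require Import boolp classical_sets reals.
From mathcomp Require Import polyrcf ring lra zify.

(** Both implications work in coordinates made of minimal vectors. Write
    [alpha] for the minimal norm of [L].

    Suppose that [L] is orthogonally symmetric. Minimal vectors generate [L], so
    three of them are linearly independent; such a triple is called a frame.
    A frame is automatically a basis of [L] ([frame_zspan]): given a lattice
    point with real coordinates [t_i] in the frame, the coordinates can be rounded
    to integers one after the other so that the cross terms never hurt, and the
    error is a lattice vector of squared length at most [3/4 alpha^2], hence 0.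
    Exchanging one vector of a frame for another minimal vector then shows that
    every minimal vector has coordinates 0, 1, -1 ([frame_coord]), so there are
    finitely many of them. The sum of [x x^T] over the minimal vectors [x]
    commutes with the symmetry group. It has a real eigenvalue because the
    dimension is odd, the eigenspace is invariant, and irreducibility forces the
    sum to be scalar ([eutaxy]).

    In a frame whose Gram matrix is [alpha^2 H] this says that [N H] is scalar,
    where the integer matrix [N] depends only on which coordinate vectors are
    minimal. The off-diagonal entries of [H] lie in [[-1/2, 1/2]], and sign changes
    of the frame make them all nonpositive or all positive; then at most four, or
    three, further pairs of minimal vectors are possible. For each possibility the
    condition on [N H] is linear in [H], and the only solutions are the Gram
    matrices of Z^3, of the body-centred and of the face-centred cubic lattice
    ([gram_classification]). Equal Gram matrices up to a factor mean similar
    lattices ([similar_zspan]).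

    Conversely, orthogonal symmetry is invariant under similarity
    ([orthogonally_symmetric_similar]), and the three cubic lattices are stable
    under signed permutations of the coordinates. That group acts irreducibly, and
    transitively on the vectors with entries 0, 1, -1 and a given number of
    nonzero entries; the minimal vectors of the three lattices are those
    with 1, 3 and 2 nonzero entries ([cubic_orthogonally_symmetric]). *)

Set Implicit Arguments.
Unset Strict Implicit.
Unset Printing Implicit Defensive.

Import Order.TTheory GRing.Theory Num.Theory.

Local Open Scope classical_set_scope.
Local Open Scope ring_scope.

(** * Inner product and orthogonal matrices *)

Section InnerProduct.
Variables (R : realType) (d : nat).
Implicit Types (x y : 'cV[R]_d) (g : 'M[R]_d).

Definition dot x y : R := (x^T *m y) 0 0.

Lemma dotE x y : dot x y = \sum_(i < d) x i 0 * y i 0.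
Proof. by rewrite /dot mxE; apply: eq_bigr => i _; rewrite mxE. Qed.

Lemma dotC x y : dot x y = dot y x.
Proof. by rewrite !dotE; apply: eq_bigr => i _; rewrite mulrC. Qed.

Lemma dotDl x x' y : dot (x + x') y = dot x y + dot x' y.
Proof. by rewrite /dot linearD mulmxDl mxE. Qed.

Lemma dotDr x y y' : dot x (y + y') = dot x y + dot x y'.
Proof. by rewrite dotC dotDl !(dotC x). Qed.

Lemma dotZl a x y : dot (a *: x) y = a * dot x y.
Proof. by rewrite /dot linearZ -scalemxAl mxE. Qed.

Lemma dotZr a x y : dot x (a *: y) = a * dot x y.
Proof. by rewrite dotC dotZl dotC. Qed.

Lemma dotNl x y : dot (- x) y = - dot x y.
Proof. by rewrite -scaleN1r dotZl mulN1r. Qed.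

Lemma dotNr x y : dot x (- y) = - dot x y.
Proof. by rewrite dotC dotNl dotC. Qed.

Lemma dot0l y : dot 0 y = 0.
Proof. by rewrite -(scale0r 0) dotZl mul0r. Qed.

Lemma dot_ge0 x : 0 <= dot x x.
Proof. by rewrite dotE sumr_ge0 // => i _; rewrite -expr2 sqr_ge0. Qed.

Lemma dot_eq0 x : (dot x x == 0) = (x == 0).
Proof.
apply/eqP/eqP => [|->]; last by rewrite dot0l.
rewrite dotE => /psumr_eq0P x0; apply/matrixP => i j; rewrite ord1 mxE.
by apply/eqP; rewrite -[_ == _]orbb -mulf_eq0 x0 // => k _; rewrite -expr2 sqr_ge0.
Qed.

Lemma dot_gt0 x : x != 0 -> 0 < dot x x.
Proof. by rewrite lt0r dot_eq0 dot_ge0 andbT. Qed.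

Lemma enormE x : enorm x = Num.sqrt (dot x x).
Proof. by rewrite dotE /enorm; congr Num.sqrt; apply: eq_bigr. Qed.

Lemma enorm_ge0 x : 0 <= enorm x.
Proof. exact: sqrtr_ge0. Qed.

Lemma enorm_sqr x : enorm x ^+ 2 = dot x x.
Proof. by rewrite enormE sqr_sqrtr ?dot_ge0. Qed.

Lemma ler_enorm x y : (enorm x <= enorm y) = (dot x x <= dot y y).
Proof. by rewrite !enormE ler_sqrt ?dot_ge0. Qed.

Lemma enorm_eqP x y : enorm x = enorm y <-> dot x x = dot y y.
Proof.
split=> [|e]; last by rewrite !enormE e.
by rewrite -!enorm_sqr => ->.
Qed.

Lemma enorm_gt0 x : (0 < enorm x) = (x != 0).
Proof. by rewrite enormE sqrtr_gt0 lt0r dot_eq0 dot_ge0 andbT. Qed.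

Lemma orthogonal_unit g : orthogonal_group g -> g \in unitmx.
Proof. by move=> /mulmx1_unit[]. Qed.

Lemma orthogonal_trmxK g : orthogonal_group g -> g^T *m g = 1%:M.
Proof. exact: mulmx1C. Qed.

Lemma dot_orthogonal g x y : orthogonal_group g -> dot (g *m x) (g *m y) = dot x y.
Proof.
by move=> /orthogonal_trmxK gg; rewrite /dot trmx_mul -mulmxA (mulmxA g^T) gg mul1mx.
Qed.

End InnerProduct.

(** * Lattices as integer spans of matrices *)

Section Lattice.
Variables (R : realType) (d : nat).
Implicit Types (x y : 'cV[R]_d) (g B : 'M[R]_d) (L : set 'cV[R]_d).

Definition zspan B : set 'cV[R]_d :=
  [set B *m map_mx intr z | z in [set: 'cV[int]_d]].

Lemma mulmx_sum_cols B (u : 'cV[R]_d) : B *m u = \sum_i u i 0 *: col i B.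
Proof.
apply/matrixP => i j; rewrite mxE summxE; apply: eq_bigr => k _.
by rewrite !mxE ord1 mulrC.
Qed.

Lemma unitmx_inj B (x y : 'cV[R]_d) : B \in unitmx -> B *m x = B *m y -> x = y.
Proof. by move=> uB e; rewrite -(mulKmx uB x) e mulKmx. Qed.

Lemma inj_unitmx B :
  (forall x, B *m x = 0 -> x = 0) -> B \in unitmx.
Proof.
move=> inj; rewrite -unitmx_tr -row_free_unit; apply: inj_row_free => v vB.
by apply: trmx_inj; rewrite trmx0; apply: inj; apply: trmx_inj; rewrite trmx_mul trmxK vB trmx0.
Qed.

Lemma is_latticeP L :
  is_lattice L <-> exists2 B : 'M[R]_d, B \in unitmx & L = zspan B.
Proof.
have E (b : d.-tuple 'cV[R]_d) B : (forall i, tnth b i = col i B) ->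
    [set \sum_(i < d) tnth b i *~ z i | z in [set: 'I_d -> int]] = zspan B.
  move=> bB; apply/seteqP; split=> _ [z _ <-].
    exists (\col_i z i) => //; rewrite mulmx_sum_cols; apply: eq_bigr => i _.
    by rewrite bB !mxE scaler_int.
  exists (fun i => z i 0) => //; rewrite mulmx_sum_cols; apply: eq_bigr => i _.
  by rewrite bB !mxE scaler_int.
split=> [[b bb ->]|[B uB ->]].
  exists (\matrix_(i, j) tnth b j i 0); last first.
    by apply: E => i; apply/matrixP => j k; rewrite !mxE ord1.
  apply: inj_unitmx => x; rewrite mulmx_sum_cols => x0.
  apply/matrixP => i j; rewrite ord1 [RHS]mxE.
  move/basis_free/freeP: bb => /(_ (fun i => x i 0)); apply.
  rewrite -{}[RHS]x0; apply: eq_bigr => k _; congr (_ *: _).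
  by apply/matrixP => a c; rewrite !mxE ord1 (tnth_nth 0).
exists [tuple col i B | i < d]; last first.
  by apply/esym/E => i; rewrite tnth_mktuple.
rewrite basisEfree subvf size_tuple dimvf dim_matrix mulr1 leqnn !andbT.
apply/freeP => k k0 i.
suff: \col_i k i = 0 by move/matrixP/(_ i 0); rewrite !mxE.
apply: (unitmx_inj uB); rewrite mulmx0 -{}[RHS]k0 mulmx_sum_cols.
by apply: eq_bigr => j _; rewrite !mxE (nth_map j) ?size_enum_ord // nth_ord_enum.
Qed.

Lemma zspan_additive B : additive_subgroup (zspan B).
Proof.
split=> [|_ _ [z _ <-] [t _ <-]].
  by exists 0 => //; rewrite map_mx0 mulmx0.
by exists (z - t) => //; rewrite map_mxB mulmxBr.
Qed.

Lemma lattice_additive L : is_lattice L -> additive_subgroup L.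
Proof. by move=> /is_latticeP[B _ ->]; exact: zspan_additive. Qed.

Lemma additiveN (A : set 'cV[R]_d) x : additive_subgroup A -> A x -> A (- x).
Proof. by move=> [A0 AB] Ax; rewrite -sub0r; apply: AB. Qed.

Lemma additiveD (A : set 'cV[R]_d) x y :
  additive_subgroup A -> A x -> A y -> A (x + y).
Proof. by move=> sA Ax Ay; rewrite -[y]opprK; apply: sA.2 => //; apply: additiveN. Qed.

Lemma additive_sum I (r : seq I) (F : I -> 'cV[R]_d) (A : set 'cV[R]_d) :
  additive_subgroup A -> (forall i, A (F i)) -> A (\sum_(i <- r) F i).
Proof.
by move=> sA AF; elim/big_ind: _ => //; [exact: sA.1 | move=> x y; exact: additiveD].
Qed.

Lemma additive_int (A : set 'cV[R]_d) x (n : int) :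
  additive_subgroup A -> A x -> A (n%:~R *: x).
Proof.
move=> sA Ax; have An k : A (k%:R *: x).
  elim: k => [|k IH]; first by rewrite scale0r; exact: sA.1.
  by rewrite -natr1 scalerDl scale1r; apply: additiveD.
case: n => k; first exact: An.
by rewrite NegzE mulrNz scaleNr; apply: additiveN => //; apply: An.
Qed.

Lemma zspan_sub (A : set 'cV[R]_d) B :
  additive_subgroup A -> (forall i, A (col i B)) -> zspan B `<=` A.
Proof.
move=> sA AB _ [z _ <-]; rewrite mulmx_sum_cols; apply: additive_sum => // i.
by rewrite mxE; apply: additive_int.
Qed.

Lemma min_norm_le L x : L x -> x != 0 -> min_norm L <= enorm x.
Proof.
move=> Lx x0; apply: ge_inf; last by exists x => //; split=> //; apply/eqP.
by exists 0 => _ [y _ <-]; exact: enorm_ge0.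
Qed.

Lemma min_norm_attained L x : L x -> x != 0 ->
  (forall y, L y -> y != 0 -> enorm x <= enorm y) -> min_norm L = enorm x.
Proof.
move=> Lx x0 xmin; apply/le_anti; rewrite min_norm_le //=.
apply: lb_le_inf; first by exists (enorm x), x => //; split => //; apply/eqP.
by move=> _ [y [Ly /eqP y0] <-]; apply: xmin.
Qed.

Lemma generates_sub L (A : set 'cV[R]_d) :
  generates (min_vectors L) L -> additive_subgroup A -> min_vectors L `<=` A -> L `<=` A.
Proof. by move=> gL sA; rewrite -{2}gL; apply: smallest_sub. Qed.

Lemma vspace_additive (V : {vspace 'cV[R]_d}) : additive_subgroup [set x | x \in V].
Proof. by split=> [|x y /=]; [exact: mem0v | exact: rpredB]. Qed.

(** A proper subspace containing every minimal vector would contain the group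
    they generate, hence a basis of the whole space. *)
Lemma min_vectors_outside L (V : {vspace 'cV[R]_d}) :
  is_lattice L -> generates (min_vectors L) L -> V != fullv ->
  exists2 v, min_vectors L v & v \notin V.
Proof.
move=> [b bb LE] gL Vn; apply: contrapT => H; move/eqP: Vn; apply.
have LV : L `<=` [set x | x \in V].
  apply: generates_sub gL (vspace_additive V) _ => x Kx /=.
  by apply/negPn/negP => xV; apply: H; exists x.
apply/eqP; rewrite eqEsubv subvf -(span_basis bb); apply/span_subvP => _ /tnthP[i ->].
apply: LV; rewrite LE; exists (fun j => (j == i)%:Z) => //.
rewrite (bigD1 i) //= eqxx mulr1z big1 ?addr0 // => j /negbTE ->.
by rewrite mulr0z.
Qed.

End Lattice.

Section Similarity.
Variables (R : realType) (d : nat).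
Implicit Types (B M : 'M[R]_d).

(** The map sending one basis to the other, divided by the ratio [k] of the
    lengths, preserves the inner product because the Gram matrices are
    proportional. *)
Lemma similar_zspan B M (k : R) : 0 < k -> B \in unitmx -> M \in unitmx ->
  M^T *m M = k ^+ 2 *: (B^T *m B) ->
  exists2 g : 'M[R]_d, orthogonal_group g & [set k *: (g *m x) | x in zspan B] = zspan M.
Proof.
move=> k0 uB uM MB; pose g := k^-1 *: (M *m invmx B).
have kg : k *: g = M *m invmx B by rewrite scalerA mulfV ?gt_eqF // scale1r.
exists g.
  apply: mulmx1C; rewrite /g -scalemxAr [(_ *: _)^T]linearZ /= -scalemxAl scalerA trmx_mul.
  rewrite -mulmxA (mulmxA M^T) MB -scalemxAl -scalemxAr scalerA.
  rewrite -!mulmxA mulmxV // mulmx1 -trmx_mul mulmxV // trmx1.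
  by rewrite -expr2 -exprMn mulVf ?gt_eqF // expr1n scale1r.
apply/seteqP; split=> [_ [_ [z _ <-] <-]|_ [z _ <-]].
  by exists z => //; rewrite scalemxAl kg -mulmxA mulKmx.
by exists (B *m map_mx intr z); [exists z | rewrite scalemxAl kg -mulmxA mulKmx].
Qed.

Lemma zspan_unimodular B (U V : 'M[int]_d) : U *m V = 1%:M ->
  zspan (B *m map_mx intr U) = zspan B.
Proof.
move=> UV; apply/seteqP; split=> _ [z _ <-].
  by exists (U *m z) => //; rewrite map_mxM mulmxA.
by exists (V *m z) => //; rewrite -mulmxA -map_mxM mulmxA UV mul1mx.
Qed.

End Similarity.

(** * Frames of minimal vectors *)

Section Frames.
Variables (R : realType) (d : nat).
Implicit Types (x y : 'cV[R]_d) (g B : 'M[R]_d) (L : set 'cV[R]_d).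

(** Let [f] be the fractional part of [t]. The squared lengths for the two
    roundings of [t], averaged with weights [1 - f] and [f], equal
    [|y|^2 + f (1 - f) |b|^2]: the cross terms cancel. One of the two is at most
    the average, and [f (1 - f) <= 1/4]. *)
Lemma rounding_step y b (t : R) : exists n : int,
  dot (y + (t - n%:~R) *: b) (y + (t - n%:~R) *: b) <= dot y y + dot b b / 4.
Proof.
pose f := t - (Num.floor t)%:~R.
have f0 : 0 <= f by rewrite subr_ge0 Num.Theory.floor_le.
have f1 : f < 1.
  by rewrite ltrBlDl -(intrD R _ 1) // Num.Theory.floorD1_gt.
pose q s := dot (y + s *: b) (y + s *: b).
have qE s : q s = dot y y + 2 * s * dot y b + s ^+ 2 * dot b b.
  by rewrite /q !(dotDl, dotDr, dotZl, dotZr) (dotC b y); ring.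
have b0 := dot_ge0 b.
have f4 : f * (1 - f) * dot b b <= dot b b / 4.
  have : 0 <= (f - 1 / 2) ^+ 2 * dot b b by rewrite mulr_ge0 // sqr_ge0.
  lra.
have avg : (1 - f) * q f + f * q (f - 1) = dot y y + f * (1 - f) * dot b b.
  by rewrite !qE; ring.
have [qf|qf] := lerP (q f) (dot y y + dot b b / 4).
  by exists (Num.floor t).
exists (Num.floor t + 1); rewrite intrD opprD addrA -/f -/(q _).
rewrite leNgt; apply/negP => qf1.
have : 0 < (1 - f) * (q f - (dot y y + dot b b / 4)) by rewrite mulr_gt0 // subr_gt0.
have : 0 <= f * (q (f - 1) - (dot y y + dot b b / 4)).
  by rewrite mulr_ge0 // subr_ge0 ltW.
lra.
Qed.

Lemma rounding n (v : 'I_n -> 'cV[R]_d) (t : 'I_n -> R) : exists z : 'I_n -> int,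
  let r := \sum_i (t i - (z i)%:~R) *: v i in dot r r <= (\sum_i dot (v i) (v i)) / 4.
Proof.
elim: n => [|n IH] in v t *.
  by exists (fun=> 0); rewrite !big_ord0 /= dot0l mul0r.
have [z zP] := IH (fun i => v (lift ord0 i)) (fun i => t (lift ord0 i)).
have [m mP] := rounding_step
  (\sum_(i < n) (t (lift ord0 i) - (z i)%:~R) *: v (lift ord0 i)) (v ord0) (t ord0).
exists (fun i => if unlift ord0 i is Some j then z j else m).
rewrite !big_ord_recl unlift_none /=.
under eq_bigr do rewrite liftK.
rewrite addrC (le_trans mP) // mulrDl [leRHS]addrC lerD2r.
exact: zP.
Qed.

Lemma min_norm_ge0 L : 0 <= min_norm L.
Proof.
rewrite /min_norm; have [->|/set0P ne] := eqVneq [set enorm y | y in L `\ 0] set0; last first.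
  by apply: lb_le_inf => // _ [y _ <-]; exact: enorm_ge0.
by rewrite inf0.
Qed.

(** The rounding error is a lattice vector of squared length at most [d/4] times
    the squared minimum, so it vanishes when [d < 4]. *)
Lemma min_vectors_round L B (t : 'cV[R]_d) : (d < 4)%N -> additive_subgroup L ->
  (forall i, min_vectors L (col i B)) -> L (B *m t) ->
  exists z : 'cV[int]_d, B *m t = B *m map_mx intr z.
Proof.
move=> d4 sL KB Lt; have [z /= zP] := rounding (fun i => col i B) (fun i => t i 0).
exists (\col_i z i); set w := map_mx _ _; apply/eqP; rewrite -subr_eq0 -mulmxBr.
set r := \sum_i _ in zP; have -> : B *m (t - w) = r.
  by rewrite mulmx_sum_cols; apply: eq_bigr => i _; rewrite !mxE.
have Lr : L r.
  have -> : r = B *m t - B *m w.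
    by rewrite -mulmxBr mulmx_sum_cols; apply: eq_bigr => i _; rewrite !mxE.
  apply: sL.2 => //; have : zspan B `<=` L by apply: zspan_sub => // i; case: (KB i).
  by apply; exists (\col_i z i).
have [//|r0] := eqVneq r 0; have ar := min_norm_le Lr r0.
have r_gt0 := dot_gt0 r0.
have ar2 : min_norm L ^+ 2 <= dot r r.
  by rewrite -enorm_sqr ler_sqr ?nnegrE ?enorm_ge0 // min_norm_ge0.
have : dot r r <= d%:R * min_norm L ^+ 2 / 4.
  apply: le_trans zP _; rewrite ler_pM2r ?invr_gt0 ?ltr0n //.
  rewrite mulr_natl -[d in _ *+ d]card_ord -sumr_const ler_sum // => i _.
  by rewrite -enorm_sqr (KB i).2.
have : d%:R * min_norm L ^+ 2 <= 3%:R * min_norm L ^+ 2 :> R.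
  by rewrite ler_wpM2r ?sqr_ge0 // ler_nat.
by move=> ? ?; exfalso; lra.
Qed.

Definition frame L B := B \in unitmx /\ forall i, min_vectors L (col i B).

Lemma frame_zspan L B : (d < 4)%N -> additive_subgroup L -> frame L B -> L = zspan B.
Proof.
move=> d4 sL [uB KB]; apply/seteqP; split=> [x Lx|]; last first.
  by apply: zspan_sub => // i; case: (KB i).
have [|z] := @min_vectors_round L B (invmx B *m x) d4 sL KB; rewrite mulKVmx // => ->.
by exists z.
Qed.

Lemma frame_ex L : is_lattice L -> generates (min_vectors L) L -> exists B, frame L B.
Proof.
move=> LL gL; have [X Xd [fX KX]] : exists2 X : seq 'cV[R]_d, size X = d &
    free X /\ forall v, v \in X -> min_vectors L v.
  suff : forall k, (k <= d)%N -> exists2 X : seq 'cV[R]_d, size X = k &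
      free X /\ forall v, v \in X -> min_vectors L v by exact.
  elim=> [|k IH] kd; first by exists [::] => //; split => //; exact: nil_free.
  have [X Xk [fX KX]] := IH (ltnW kd).
  have [|v Kv vX] := @min_vectors_outside _ _ L <<X>>%VS LL gL.
    apply: contraTneq kd => /(congr1 (fun V : {vspace _} => \dim V)).
    rewrite dimvf dim_matrix mulr1 (eqnP fX) Xk => ->.
    by rewrite ltnn.
  exists (v :: X); first by rewrite /= Xk.
  split=> [|w]; first by rewrite free_cons vX.
  by rewrite inE => /predU1P[->|/KX].
exists (\matrix_(i, j) X`_j i 0).
have colX i : col i (\matrix_(i, j) X`_j i 0) = X`_i.
  by apply/matrixP => a b; rewrite !mxE ord1.
split=> [|i]; last by rewrite colX; apply/KX/mem_nth; rewrite Xd.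
apply: inj_unitmx => x; rewrite mulmx_sum_cols => x0.
apply/matrixP => i j; rewrite ord1 [RHS]mxE.
have fX' : free (tcast Xd (in_tuple X)) by rewrite val_tcast.
move/freeP: fX' => /(_ (fun i => x i 0)); apply; rewrite -{}[RHS]x0.
by apply: eq_bigr => k _; rewrite val_tcast colX.
Qed.

Lemma min_vectorsN L x : additive_subgroup L -> min_vectors L x -> min_vectors L (- x).
Proof.
move=> sL [Lx xm]; split; first exact: additiveN.
by rewrite -xm; apply/enorm_eqP; rewrite dotNl dotNr opprK.
Qed.

(** If the coordinate [z_i] is nonzero, the frame vector [b_i] is a real
    combination of [v = B z] and of the other [b_j]. These are minimal vectors, so
    by rounding [b_i] is also an integral combination of them, and comparing the
    coefficients of [b_i] makes [z_i] invertible among the integers. *)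
Lemma frame_coord L B (z : 'cV[int]_d) i : (d < 4)%N -> additive_subgroup L ->
  frame L B -> min_vectors L (B *m map_mx intr z) -> z i 0 \in [:: 0; 1; -1].
Proof.
move=> d4 sL [uB KB] Kz; have [->//|z0] := eqVneq (z i 0) 0.
(* [B E] is the frame with its [i]-th vector replaced by [B z], and [t] gives
   the coordinates of the old [i]-th vector in it. *)
pose E := \matrix_(k, j) if j == i then (z k 0)%:~R else (k == j)%:R : R.
pose t := \col_j (if j == i then (z i 0)%:~R^-1 else - (z j 0)%:~R / (z i 0)%:~R) : 'cV[R]_d.
have zR : (z i 0)%:~R != 0 :> R by rewrite intr_eq0.
have Emul u k : (E *m u) k 0 = (z k 0)%:~R * u i 0 + (k != i)%:R * u k 0.
  rewrite mxE (bigD1 i) //= !mxE eqxx; congr (_ + _).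
  have [->|ki] := eqVneq k i.
    by rewrite mul0r big1 // => j ji; rewrite !mxE (negbTE ji) eq_sym (negbTE ji) mul0r.
  rewrite (bigD1 k) //= !mxE (negbTE ki) eqxx big1 ?addr0 // => j /andP[ji jk].
  by rewrite !mxE (negbTE ji) eq_sym (negbTE jk) mul0r.
have Et : E *m t = delta_mx i 0.
  apply/matrixP => k j; rewrite ord1 Emul !mxE eqxx.
  have [->|ki] := eqVneq k i; first by rewrite mul0r addr0 mulfV.
  by rewrite mul1r mulNr subrr.
have colBE k : B *m col k E = if k == i then B *m map_mx intr z else col k B.
  case: eqP => [->|/eqP ki]; first by congr (_ *m _); apply/matrixP => a b; rewrite !mxE eqxx ord1.
  by rewrite [RHS]colE; congr (_ *m _); apply/matrixP => a b; rewrite !mxE (negbTE ki) ord1 eqxx andbT.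
have [||w] := @min_vectors_round L (B *m E) t d4 sL.
- by move=> k; rewrite colE -mulmxA -colE colBE; case: eqP.
- by rewrite -mulmxA Et -colE; case: (KB i).
rewrite -!mulmxA => /(unitmx_inj uB); rewrite Et => /matrixP/(_ i 0).
rewrite Emul eqxx mul0r addr0 !mxE !eqxx -intrM => /eqP.
rewrite eq_sym (eqr_int R _ 1) => /eqP zw.
have : z i 0 \is a GRing.unit by apply/unitrPr; exists (w i 0).
by rewrite !inE => /orP[] ->; rewrite ?orbT.
Qed.

End Frames.

(** * Eutaxy of the minimal vectors *)

Section Eutaxy.
Variables (R : realType) (d : nat).
Implicit Types (x y : 'cV[R]_d) (g B : 'M[R]_d) (L : set 'cV[R]_d).

(** Schur's argument over the reals: in odd dimension the characteristic
    polynomial has a real root, and the eigenspace is stable under [G]. Eigenvectors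
    of matrices are row vectors, whence the transpose. *)
Lemma commuting_scalar (G : set 'M[R]_d) (M : 'M[R]_d) : odd d ->
  irreducible_action G -> (forall g, G g -> g *m M = M *m g) ->
  exists a, M = a%:M.
Proof.
move=> d_odd irr GM.
have [|a ra] := @odd_poly_root R (char_poly M^T); first by rewrite size_char_poly /= d_odd.
have /eigenvalueP[v va v0] : eigenvalue M^T a by rewrite eigenvalue_root_char.
exists a; pose f := linfun (mulmx (M - a%:M) : 'cV[R]_d -> 'cV[R]_d).
have fE x : (x \in lker f) = (M *m x == a *: x).
  by rewrite memv_ker lfunE /= mulmxBl mul_scalar_mx subr_eq0.
have [g Gg x|f0|fT] := irr (lker f).
- rewrite !fE => /eqP Mx; apply/eqP.
  by rewrite mulmxA -GM // -mulmxA Mx -scalemxAr.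
- have : v^T \in lker f.
    by rewrite fE; apply/eqP/trmx_inj; rewrite trmx_mul trmxK va linearZ /= trmxK.
  by rewrite f0 memv0 -(trmx0 R) (inj_eq (@trmx_inj _ _ _)) (negbTE v0).
apply/matrixP => i j; have : delta_mx j 0 \in lker f by rewrite fT memvf.
rewrite fE => /eqP; rewrite -colE => /matrixP/(_ i 0); rewrite !mxE => ->.
by rewrite eqxx andbT mulr_natr.
Qed.

(** Conjugating the sum by an element of [G] permutes its terms, so the sum
    commutes with [G]. *)
Lemma eutaxy (G : set 'M[R]_d) (s : seq 'cV[R]_d) : odd d ->
  irreducible_action G -> G `<=` @orthogonal_group R d -> uniq s ->
  (forall g x, G g -> x \in s -> g *m x \in s) ->
  exists a, \sum_(x <- s) x *m x^T = a%:M.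
Proof.
move=> d_odd irr GO us Gs; apply: commuting_scalar d_odd irr _ => g Gg.
have gO : g *m g^T = 1%:M by exact: GO.
have gV := orthogonal_trmxK gO.
have inj : injective (mulmx g : 'cV[R]_d -> 'cV[R]_d).
  by move=> x y; apply: unitmx_inj; apply: orthogonal_unit.
suff e : g *m (\sum_(x <- s) x *m x^T) *m g^T = \sum_(x <- s) x *m x^T.
  by rewrite -[in RHS]e -!mulmxA gV mulmx1.
have p : perm_eq [seq g *m x | x <- s] s.
  have us' : uniq [seq g *m x | x <- s] by rewrite map_inj_uniq.
  apply: uniq_perm => //; apply: (uniq_min_size us' _ _).2.
    by move=> _ /mapP[x xs ->]; apply: Gs.
  by rewrite size_map.
rewrite -[RHS](perm_big _ p) big_map mulmx_sumr mulmx_suml.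
by apply: eq_bigr => x _; rewrite trmx_mul !mulmxA.
Qed.

Lemma symmetry_min_vectors L g x :
  symmetry_group L g -> min_vectors L x -> min_vectors L (g *m x).
Proof.
move=> [gO gL] [Lx xm]; split; first by rewrite -gL; exists x.
by rewrite -xm; apply/enorm_eqP; rewrite dot_orthogonal.
Qed.

(** Eutaxy in the coordinates of a frame: if [N] is the sum of [z z^T] over the
    coordinate vectors of the minimal vectors, the scalar matrix of [eutaxy]
    is [B N B^T], and conjugating it by [B] gives [N (B^T B)]. *)
Lemma frame_eutaxy L B (cube : seq 'cV[int]_d) : odd d -> (d < 4)%N ->
  additive_subgroup L -> irreducible_action (symmetry_group L) -> frame L B ->
  uniq cube -> (forall z : 'cV[int]_d, (forall i, z i 0 \in [:: 0; 1; -1]) -> z \in cube) ->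
  exists a, (\sum_(z <- cube | enorm (B *m map_mx intr z) == min_norm L)
    map_mx intr z *m (map_mx intr z)^T) *m (B^T *m B) = a%:M.
Proof.
move=> d_odd d4 sL irr FB uc cubeP; have [uB KB] := FB.
pose P (z : 'cV[int]_d) := enorm (B *m map_mx intr z) == min_norm L.
pose s := [seq B *m map_mx intr z | z <- cube & P z].
have LB := frame_zspan d4 sL FB.
have sP x : min_vectors L x <-> x \in s.
  split=> [Kx|/mapP[z]].
    have := Kx.1; rewrite LB => -[z _ zx]; apply/mapP; exists z => //.
    rewrite mem_filter cubeP ?andbT; first by rewrite /P zx; apply/eqP/Kx.2.
    by move=> i; apply: frame_coord FB _ => //; rewrite zx.
  rewrite mem_filter => /andP[/eqP Pz _] ->; split=> //.
  by rewrite LB; exists z.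
have [||g x Gg|a aP] := @eutaxy _ s d_odd irr.
- by move=> g [].
- rewrite map_inj_uniq ?filter_uniq // => z t /(unitmx_inj uB) e.
  apply/matrixP => i j; move/matrixP/(_ i j)/eqP: e; rewrite !mxE eqr_int.
  by move/eqP.
- by rewrite -!sP; apply: symmetry_min_vectors.
exists a; set N := \sum_(z <- _ | _) _.
have BNB : B *m N *m B^T = a%:M.
  rewrite -aP big_map big_filter mulmx_sumr mulmx_suml; apply: eq_bigr => z _.
  by rewrite trmx_mul !mulmxA.
have -> : N *m (B^T *m B) = invmx B *m (B *m N *m B^T) *m B.
  by rewrite !mulmxA mulVmx // mul1mx.
by rewrite BNB mul_mx_scalar -scalemxAl mulVmx // scalemx1.
Qed.

End Eutaxy.

(** * Classification of the ternary Gram matrices *)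

Definition entry3 (T : Type) (t : T * T * T) (i : 'I_3) : T :=
  match val i with 0 => t.1.1 | 1 => t.1.2 | _ => t.2 end.

Lemma entry3E (T : Type) (x y z : T) :
  (entry3 (x, y, z) 0 = x) * (entry3 (x, y, z) 1 = y) * (entry3 (x, y, z) 2 = z).
Proof. by []. Qed.

Lemma sum3 (V : nmodType) (F : 'I_3 -> V) : \sum_i F i = F 0 + F 1 + F 2.
Proof.
rewrite !big_ord_recl big_ord0 addr0 addrA; congr (F _ + F _ + F _); exact: val_inj.
Qed.

Definition col3 (T : Type) (t : T * T * T) : 'cV[T]_3 := \col_i entry3 t i.

Definition mx3 (T : Type) (r0 r1 r2 : T * T * T) : 'M[T]_3 :=
  \matrix_(i, j) entry3 (entry3 (r0, r1, r2) i) j.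

Lemma ord3_ind (P : 'I_3 -> Prop) : P 0 -> P 1 -> P 2 -> forall i, P i.
Proof.
move=> P0 P1 P2 [[|[|[|//]]] lti].
- by have -> : Ordinal lti = 0 by exact: val_inj.
- by have -> : Ordinal lti = 1 by exact: val_inj.
- by have -> : Ordinal lti = 2 by exact: val_inj.
Qed.

Lemma matrix3P (T : Type) (A B : 'M[T]_3) :
  (forall i, [/\ A i 0 = B i 0, A i 1 = B i 1 & A i 2 = B i 2]) -> A = B.
Proof.
by move=> e; apply/matrixP => i j; have [? ? ?] := e i; elim/ord3_ind: j.
Qed.

(** One vector from each pair of opposite nonzero vectors with entries 0, 1, -1. *)
Definition half_cube : seq (int * int * int) :=
  [:: (1, 0, 0); (0, 1, 0); (0, 0, 1);
      (1, 1, 0); (1, -1, 0); (1, 0, 1); (1, 0, -1); (0, 1, 1); (0, 1, -1);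
      (1, 1, 1); (1, 1, -1); (1, -1, 1); (-1, 1, 1)].

Section Classification.
Variable R : realType.
Implicit Types (a b c : R).

(** Gram matrix of unit vectors [v0, v1, v2]: [a], [b], [c] are the inner products
    [v1.v2], [v0.v2], [v0.v1]. *)
Definition gram3 a b c : 'M[R]_3 := mx3 (1, c, b) (c, 1, a) (b, a, 1).

Definition qform3 a b c (x y z : R) : R :=
  x ^+ 2 + y ^+ 2 + z ^+ 2 + 2 * (c * x * y + b * x * z + a * y * z).

(** In a frame with normalized Gram matrix [gram3 a b c], these are the coordinate
    vectors of the minimal vectors. *)
Definition short a b c (t : int * int * int) : bool :=
  qform3 a b c t.1.1%:~R t.1.2%:~R t.2%:~R == 1.

Lemma shortE a b c :
  (short a b c (1, 0, 0) = true) * (short a b c (0, 1, 0) = true) *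
  (short a b c (0, 0, 1) = true) *
  (short a b c (1, 1, 0) = (c == - (1 / 2))) * (short a b c (1, -1, 0) = (c == 1 / 2)) *
  (short a b c (1, 0, 1) = (b == - (1 / 2))) * (short a b c (1, 0, -1) = (b == 1 / 2)) *
  (short a b c (0, 1, 1) = (a == - (1 / 2))) * (short a b c (0, 1, -1) = (a == 1 / 2)) *
  (short a b c (1, 1, 1) = (a + b + c == -1)) * (short a b c (1, 1, -1) = (c - a - b == -1)) *
  (short a b c (1, -1, 1) = (b - a - c == -1)) * (short a b c (-1, 1, 1) = (a - b - c == -1)).
Proof.
rewrite /short /qform3 /= !mulrNz !mulr0z !mulr1z.
do !split; first [by apply/eqP; lra | by apply/eqP/eqP => ?; lra].
Qed.

(** With inner products in [[-1/2, 0]], a difference of two frame vectors is longer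
    than they are; so is [v0 + v1 - v2], of squared length
    [3 + 2 (c - a - b) >= 2], and likewise for the other mixed signs. *)
Lemma sum_short_nonpos (V : nmodType) (F : int * int * int -> V) a b c :
  [/\ - (1 / 2) <= a <= 0, - (1 / 2) <= b <= 0 & - (1 / 2) <= c <= 0] ->
  \sum_(t <- half_cube | short a b c t) F t =
    F (1, 0, 0) + F (0, 1, 0) + F (0, 0, 1) + F (1, 1, 0) *+ (c == - (1 / 2)) +
    F (1, 0, 1) *+ (b == - (1 / 2)) + F (0, 1, 1) *+ (a == - (1 / 2)) +
    F (1, 1, 1) *+ (a + b + c == -1).
Proof.
move=> [/andP[? ?] /andP[? ?] /andP[? ?]].
have ne (x y : R) : x != y -> (x == y) = false by move/negbTE.
rewrite big_mkcond !big_cons big_nil !shortE.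
rewrite (ne a (1 / 2)); last by apply/eqP; lra.
rewrite (ne b (1 / 2)); last by apply/eqP; lra.
rewrite (ne c (1 / 2)); last by apply/eqP; lra.
rewrite (ne (c - a - b)); last by apply/eqP; lra.
rewrite (ne (b - a - c)); last by apply/eqP; lra.
rewrite (ne (a - b - c)); last by apply/eqP; lra.
by rewrite /= -!mulrb !add0r addr0 !addrA.
Qed.

(** With positive inner products, only differences of two frame vectors can be
    short: [v0 + v1 - v2] has squared length [3 + 2 (c - a - b) > 1], as [a] and [b]
    are at most 1/2. *)
Lemma sum_short_pos (V : nmodType) (F : int * int * int -> V) a b c :
  [/\ 0 < a <= 1 / 2, 0 < b <= 1 / 2 & 0 < c <= 1 / 2] ->
  \sum_(t <- half_cube | short a b c t) F t =
    F (1, 0, 0) + F (0, 1, 0) + F (0, 0, 1) + F (1, -1, 0) *+ (c == 1 / 2) +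
    F (1, 0, -1) *+ (b == 1 / 2) + F (0, 1, -1) *+ (a == 1 / 2).
Proof.
move=> [/andP[? ?] /andP[? ?] /andP[? ?]].
have ne (x y : R) : x != y -> (x == y) = false by move/negbTE.
rewrite big_mkcond !big_cons big_nil !shortE.
rewrite (ne a (- (1 / 2))); last by apply/eqP; lra.
rewrite (ne b (- (1 / 2))); last by apply/eqP; lra.
rewrite (ne c (- (1 / 2))); last by apply/eqP; lra.
rewrite (ne (a + b + c)); last by apply/eqP; lra.
rewrite (ne (c - a - b)); last by apply/eqP; lra.
rewrite (ne (b - a - c)); last by apply/eqP; lra.
rewrite (ne (a - b - c)); last by apply/eqP; lra.
by rewrite /= -!mulrb !add0r addr0 !addrA.
Qed.

Definition short_moments a b c : 'M[R]_3 :=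
  \sum_(t <- half_cube | short a b c t)
    map_mx intr (col3 t) *m (map_mx intr (col3 t))^T.

(** The Gram matrices of Z^3, of the body-centred cubic lattice, and of the
    face-centred cubic lattice: in the last, the frame consists either of three
    vectors at mutual angle 60 degrees, or of two orthogonal vectors both at
    120 degrees to the third. *)
Definition form_classes a b c : Prop :=
  [\/ (a = 0 /\ b = 0 /\ c = 0) ,
      (a = - (1 / 3) /\ b = - (1 / 3) /\ c = - (1 / 3)) ,
      (a = 1 / 2 /\ b = 1 / 2 /\ c = 1 / 2) |
      [\/ (a = 0 /\ b = - (1 / 2) /\ c = - (1 / 2)) ,
      (a = - (1 / 2) /\ b = 0 /\ c = - (1 / 2)) |
      (a = - (1 / 2) /\ b = - (1 / 2) /\ c = 0)]].

Lemma mulmx_gram3 (N : 'M[R]_3) a b c l : N *m gram3 a b c = l%:M ->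
  forall i, [/\ N i 0 + N i 1 * c + N i 2 * b = l *+ (i == 0),
    N i 0 * c + N i 1 + N i 2 * a = l *+ (i == 1) &
    N i 0 * b + N i 1 * a + N i 2 = l *+ (i == 2)].
Proof.
move=> /matrixP e i; split.
- by have := e i 0; rewrite !mxE sum3 !mxE !entry3E mulr1.
- by have := e i 1; rewrite !mxE sum3 !mxE !entry3E mulr1.
- by have := e i 2; rewrite !mxE sum3 !mxE !entry3E mulr1.
Qed.

Lemma short_momentsE a b c i j : short_moments a b c i j =
  \sum_(t <- half_cube | short a b c t) (entry3 t i)%:~R * (entry3 t j)%:~R.
Proof.
by rewrite summxE; apply: eq_bigr => t _; rewrite mxE big_ord1 !mxE.
Qed.

Local Ltac solve_form_classes :=
  first [exfalso; lra
        | constructor 1; do !split; lra | constructor 2; do !split; lra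
        | constructor 3; do !split; lra
        | constructor 4; constructor 1; do !split; lra
        | constructor 4; constructor 2; do !split; lra
        | constructor 4; constructor 3; do !split; lra ].

(** The sign condition leaves 16 or 8 possible sets of short vectors. For each of
    them the moment matrix is known and the eutaxy equation becomes a linear
    system in [a], [b], [c], [l], which is contradictory or fixes one class. *)
Lemma gram_classification a b c l :
  [/\ `|a| <= 1 / 2, `|b| <= 1 / 2 & `|c| <= 1 / 2] ->
  [/\ a <= 0, b <= 0 & c <= 0] \/ [/\ 0 < a, 0 < b & 0 < c] ->
  short_moments a b c *m gram3 a b c = l%:M ->
  form_classes a b c.
Proof.
rewrite !ler_norml => -[/andP[a1 a2] /andP[b1 b2] /andP[c1 c2]] sgn /mulmx_gram3 H.
have [e00 e01 e02] := H 0; have [e10 e11 e12] := H 1; have [e20 e21 e22] := H 2.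
move: {H} e00 e01 e02 e10 e11 e12 e20 e21 e22; rewrite !eqxx.
rewrite !(eq_sym _ (0 : 'I_3)) ![_ == _ :> 'I_3]/= !mulr0n !mulr1n !short_momentsE.
case: sgn => [[a0 b0 c0]|[a0 b0 c0]].
  rewrite !sum_short_nonpos ?a0 ?b0 ?c0 ?a1 ?b1 ?c1 //.
  rewrite !entry3E !mulr0z !mulr1z !(mulr0, mul0r, mulr1, addr0, add0r, mul0rn).
  do ![case: eqP => ?]; rewrite !(mulr0n, mulr1n) => *; solve_form_classes.
rewrite !sum_short_pos ?a0 ?b0 ?c0 ?a2 ?b2 ?c2 //.
rewrite !entry3E !mulrNz !mulr0z !mulr1z !(mulr0, mul0r, mulr1, addr0, add0r, mul0rn, oppr0).
do ![case: eqP => ?]; rewrite !(mulr0n, mulr1n) => *; solve_form_classes.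
Qed.

End Classification.

(** * Gram matrices of frames in dimension three *)

Lemma col3K (T : Type) (z : 'cV[T]_3) : col3 (z 0 0, z 1 0, z 2 0) = z.
Proof. by apply/matrixP => i j; rewrite ord1 !mxE; elim/ord3_ind: i. Qed.

Lemma col3_inj (T : Type) : injective (@col3 T).
Proof.
move=> [[x y] z] [[x' y'] z'] /matrixP e.
by have := (e 0 0, e 1 0, e 2 0); rewrite !mxE !entry3E => -[[-> ->] ->].
Qed.

Definition opp3 (t : int * int * int) := (- t.1.1, - t.1.2, - t.2).

Lemma col3N t : col3 (opp3 t) = - col3 t.
Proof. by apply/matrixP => i j; rewrite !mxE; elim/ord3_ind: i. Qed.

Definition cube : seq 'cV[int]_3 :=
  [seq col3 t | t <- (0, 0, 0) :: half_cube ++ [seq opp3 t | t <- half_cube]].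

Lemma cube_uniq : uniq cube.
Proof. rewrite map_inj_uniq //; exact: col3_inj. Qed.

Lemma mem_cube (z : 'cV[int]_3) :
  (forall i, z i 0 \in [:: 0; 1; -1]) -> z \in cube.
Proof.
move=> zU; rewrite -[z]col3K; apply: map_f; move: (zU 0) (zU 1) (zU 2).
by rewrite !inE; do 3 (case/or3P => /eqP ->).
Qed.

Section TernaryFrames.
Variable R : realType.
Implicit Types (a b c : R) (L : set 'cV[R]_3) (B : 'M[R]_3).

Lemma gram3_qform a b c (u : 'cV[R]_3) :
  (u^T *m gram3 a b c *m u) 0 0 = qform3 a b c (u 0 0) (u 1 0) (u 2 0).
Proof.
rewrite !mxE sum3 !mxE !sum3 !mxE !entry3E /qform3; ring.
Qed.

Definition normalized_gram L B a b c : Prop :=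
  B^T *m B = min_norm L ^+ 2 *: gram3 a b c.

Lemma gramE d (B : 'M[R]_d) i j : (B^T *m B) i j = dot (col i B) (col j B).
Proof. by rewrite dotE mxE; apply: eq_bigr => k _; rewrite !mxE. Qed.

Lemma frame_gram L B : 0 < min_norm L -> frame L B ->
  let h i j := dot (col i B) (col j B) / min_norm L ^+ 2 in
  normalized_gram L B (h 1 2) (h 0 2) (h 0 1).
Proof.
move=> a0 [_ KB] h; have a2 : min_norm L ^+ 2 != 0 by rewrite expf_neq0 ?gt_eqF.
have hd i : dot (col i B) (col i B) = min_norm L ^+ 2 by rewrite -enorm_sqr (KB i).2.
have hE i j : min_norm L ^+ 2 * h i j = dot (col i B) (col j B).
  by rewrite mulrC divfK.
apply: matrix3P => i; elim/ord3_ind: i; split; rewrite gramE !mxE !entry3E ?hE ?mulr1 ?hd //;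
  by rewrite dotC.
Qed.

Lemma frame_qform L B a b c (u : 'cV[R]_3) : normalized_gram L B a b c ->
  dot (B *m u) (B *m u) = min_norm L ^+ 2 * qform3 a b c (u 0 0) (u 1 0) (u 2 0).
Proof.
move=> g; rewrite /dot trmx_mul -mulmxA (mulmxA B^T) g -scalemxAl -scalemxAr mxE.
by rewrite mulmxA gram3_qform.
Qed.

(** No nonzero lattice vector is shorter than the minimum. *)
Lemma qform3_ge1 L B a b c (t : int * int * int) : 0 < min_norm L ->
  additive_subgroup L -> frame L B -> normalized_gram L B a b c -> t != (0, 0, 0) ->
  1 <= qform3 a b c t.1.1%:~R t.1.2%:~R t.2%:~R.
Proof.
move=> a0 sL FB g t0; pose z : 'cV[R]_3 := map_mx intr (col3 t).
have -> : qform3 a b c t.1.1%:~R t.1.2%:~R t.2%:~R = qform3 a b c (z 0 0) (z 1 0) (z 2 0).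
  by rewrite !mxE.
rewrite -(ler_pM2l (exprn_gt0 2 a0)) mulr1 -(frame_qform _ g) -enorm_sqr.
rewrite ler_sqr ?nnegrE ?enorm_ge0 ?(ltW a0) //; apply: min_norm_le.
  by rewrite (@frame_zspan _ _ _ _ _ sL FB) //; exists (col3 t).
apply: contra_neq t0 => z0; apply: col3_inj; apply/matrixP => i j.
have /matrixP/(_ i j)/eqP : z = 0 by apply: (unitmx_inj FB.1); rewrite mulmx0.
by rewrite !mxE intr_eq0 => /eqP ->; elim/ord3_ind: i.
Qed.

(** Apply the minimum to the sums and differences of two frame vectors. *)
Lemma normalized_gram_bound L B a b c : 0 < min_norm L ->
  additive_subgroup L -> frame L B -> normalized_gram L B a b c ->
  [/\ `|a| <= 1 / 2, `|b| <= 1 / 2 & `|c| <= 1 / 2].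
Proof.
move=> a0 sL FB g; have q1 t := @qform3_ge1 L B a b c t a0 sL FB g.
have := (q1 (1, 1, 0) isT, q1 (1, -1, 0) isT, q1 (1, 0, 1) isT, q1 (1, 0, -1) isT).
have := (q1 (0, 1, 1) isT, q1 (0, 1, -1) isT).
rewrite /qform3 /= !mulrNz !mulr0z !mulr1z !ler_norml => -[? ?] [[[? ?] ?] ?].
by split; lra.
Qed.

(** Changing the sign of a frame vector changes two of the three inner products,
    so the sign of their product is all that cannot be normalized; the sign of
    the first frame vector can be kept, since only relative signs matter. *)
Lemma sign_normalization a b c : exists e1 e2 : bool,
  let a' := (-1) ^+ e1 * (-1) ^+ e2 * a in
  let b' := (-1) ^+ e2 * b in
  let c' := (-1) ^+ e1 * c in
  [/\ a' <= 0, b' <= 0 & c' <= 0] \/ [/\ 0 < a', 0 < b' & 0 < c'].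
Proof.
case: (ltrgt0P a) => ?; case: (ltrgt0P b) => ?; case: (ltrgt0P c) => ?;
first [exists false, false; rewrite !expr0 ?expr1; first [left; split; lra | right; split; lra]
      |exists false, true; rewrite !expr0 ?expr1; first [left; split; lra | right; split; lra]
      |exists true, false; rewrite !expr0 ?expr1; first [left; split; lra | right; split; lra]
      |exists true, true; rewrite ?expr1; first [left; split; lra | right; split; lra]].
Qed.

Lemma frame_signs L B (e : 'I_3 -> bool) : additive_subgroup L -> frame L B ->
  frame L (\matrix_(i, j) ((-1) ^+ e j * B i j)).
Proof.
move=> sL [uB KB]; have colE j : col j (\matrix_(i, j) ((-1) ^+ e j * B i j)) = (-1) ^+ e j *: col j B.
  by apply/matrixP => i k; rewrite !mxE.
split=> [|j]; last first.
  by rewrite colE; case: (e j); rewrite ?scaleN1r ?scale1r //; apply: min_vectorsN.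
apply: inj_unitmx => x; rewrite mulmx_sum_cols => x0.
apply/matrixP => j k; rewrite ord1 [RHS]mxE.
have : \col_j ((-1) ^+ e j * x j 0) = 0.
  apply: (unitmx_inj uB); rewrite mulmx0 -{}[RHS]x0 mulmx_sum_cols.
  by apply: eq_bigr => i _; rewrite colE scalerA mxE mulrC.
by move/matrixP/(_ j 0)/eqP; rewrite !mxE mulf_eq0 signr_eq0 => /eqP.
Qed.

Lemma frame_signed_gram L B a b c (e : 'I_3 -> bool) : normalized_gram L B a b c ->
  normalized_gram L (\matrix_(i, j) ((-1) ^+ e j * B i j))
   ((-1) ^+ e 1 * (-1) ^+ e 2 * a) ((-1) ^+ e 0 * (-1) ^+ e 2 * b) ((-1) ^+ e 0 * (-1) ^+ e 1 * c).
Proof.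
move=> g; apply/matrixP => i j.
have -> : ((\matrix_(i, j) ((-1) ^+ e j * B i j))^T *m (\matrix_(i, j) ((-1) ^+ e j * B i j))) i j
   = (-1) ^+ e i * (-1) ^+ e j * (B^T *m B) i j.
  by rewrite !mxE mulr_sumr; apply: eq_bigr => k _; rewrite !mxE; ring.
rewrite g !mxE; elim/ord3_ind: i; elim/ord3_ind: j; rewrite !entry3E;
by case: (e 0); case: (e 1); case: (e 2); rewrite ?expr0 ?expr1; ring.
Qed.

Lemma reduced_frame L : is_lattice L -> generates (min_vectors L) L -> 0 < min_norm L ->
  exists B a b c, [/\ frame L B, normalized_gram L B a b c &
    [/\ a <= 0, b <= 0 & c <= 0] \/ [/\ 0 < a, 0 < b & 0 < c]].
Proof.
move=> LL gL a0; have [B FB] := frame_ex LL gL.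
have sL := lattice_additive LL.
have /= := frame_gram a0 FB; set a := _ / _; set b := _ / _; set c := _ / _ => g.
have [e1 [e2 sgn]] := sign_normalization a b c.
pose e i := entry3 (false, e1, e2) i.
exists (\matrix_(i, j) ((-1) ^+ e j * B i j)).
have := frame_signed_gram e g; rewrite /e !entry3E expr0 !mul1r => g'.
by do 3 eexists; split; [exact: frame_signs | exact: g' | exact: sgn].
Qed.

Lemma min_norm_gt0 d (L : set 'cV[R]_d) : (0 < d)%N -> is_lattice L ->
  generates (min_vectors L) L -> 0 < min_norm L.
Proof.
move=> d0 LL gL; have [B [uB KB]] := frame_ex LL gL.
rewrite -(KB (Ordinal d0)).2 enorm_gt0; apply/eqP => B0.
have /(unitmx_inj uB) : B *m delta_mx (Ordinal d0) 0 = B *m (0 : 'cV_d).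
  by rewrite -colE B0 mulmx0.
by move/matrixP/(_ (Ordinal d0) 0)/eqP; rewrite !mxE !eqxx oner_eq0.
Qed.

(** The minimal vectors come in opposite pairs, so the sum in [frame_eutaxy] is
    twice the sum over [half_cube]. *)
Lemma frame_form_classes L B a b c :
  is_lattice L -> generates (min_vectors L) L -> irreducible_action (symmetry_group L) ->
  frame L B -> normalized_gram L B a b c ->
  [/\ a <= 0, b <= 0 & c <= 0] \/ [/\ 0 < a, 0 < b & 0 < c] -> form_classes a b c.
Proof.
move=> LL gL irr FB g sgn.
have a0 : 0 < min_norm L by apply: min_norm_gt0.
have sL := lattice_additive LL.
have bd := normalized_gram_bound a0 sL FB g.
have [l lP] := @frame_eutaxy R 3 L B cube isT isT sL irr FB cube_uniq mem_cube.
apply: (@gram_classification _ _ _ _ (l / (2 * min_norm L ^+ 2)) bd sgn).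
have a2 : 2 * min_norm L ^+ 2 != 0 by rewrite mulf_neq0 ?expf_neq0 ?gt_eqF ?pnatr_eq0.
have PE t : (enorm (B *m map_mx intr (col3 t)) == min_norm L) = short a b c t.
  rewrite -(@eqrXn2 _ 2) ?enorm_ge0 ?(ltW a0) // enorm_sqr (frame_qform _ g) !mxE.
  by rewrite -[X in _ == X]mulr1 (inj_eq (mulfI _)) // expf_neq0 ?gt_eqF.
have shortN t : short a b c (opp3 t) = short a b c t.
  by rewrite /short /= !mulrNz; congr (_ == _); rewrite /qform3; ring.
move: lP; have -> : \sum_(z <- cube | enorm (B *m map_mx intr z) == min_norm L)
    map_mx intr z *m (map_mx intr z)^T = 2 *: short_moments a b c :> 'M[R]_3.
  have F0 : map_mx intr (col3 (0, 0, 0)) = 0 :> 'cV[R]_3.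
    by apply/matrixP => i j; rewrite !mxE; elim/ord3_ind: i.
  rewrite /cube big_map (eq_bigl _ _ PE) big_cons F0 mul0mx add0r if_same big_cat big_map /=.
  rewrite scaler_nat mulr2n; congr (_ + _); apply: eq_big => t; first exact: shortN.
  by rewrite col3N map_mxN linearN mulmxN mulNmx opprK.
rewrite g -scalemxAl -scalemxAr scalerA => e.
by apply: (scalerI a2); rewrite e scale_scalar_mx mulrC divfK.
Qed.

End TernaryFrames.

(** * The three cubic lattices *)

Definition basis_DT : 'M[int]_3 := mx3 (1, 1, -1) (1, -1, 1) (-1, 1, 1).
Definition basis_D : 'M[int]_3 := mx3 (1, 1, 0) (1, 0, 1) (0, 1, 1).

Local Ltac mx3_compute :=
  apply: matrix3P; elim/ord3_ind; split; rewrite !mxE ?sum3 ?mxE !entry3E.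

(** Up to the factor 2, the face-centred and the body-centred cubic lattices are
    dual to each other. *)
Lemma basis_D_DT : basis_D *m basis_DT = 2%:M.
Proof. by mx3_compute. Qed.

Lemma basis_DT_D : basis_DT *m basis_D = 2%:M.
Proof. by mx3_compute. Qed.

Section Models.
Variable R : realType.

Definition mxint (M : 'M[int]_3) : 'M[R]_3 := map_mx intr M.

(** When [P Q = 2], [P w = z] is equivalent to [Q z = 2 w], so that the lattice
    spanned by [P] is cut out by the congruences [Q z = 0] modulo 2. *)
Lemma zspan_congruence (P Q : 'M[int]_3) : P *m Q = 2%:M -> Q *m P = 2%:M ->
  zspan (mxint P) =
  [set map_mx intr z | z in [set z : 'cV[int]_3 | forall i, (2 %| ((Q *m z) i 0)%R)%Z]].
Proof.
move=> PQ QP; apply/seteqP; split=> [_ [w _ <-]|_ [z zQ <-]].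
  exists (P *m w) => [i|]; last by rewrite map_mxM.
  by rewrite mulmxA QP mul_scalar_mx mxE dvdz_mulr.
pose w : 'cV_3 := \col_i (((Q *m z) i 0)%R %/ 2)%Z.
exists w => //; rewrite -map_mxM; congr map_mx.
have /(congr1 (mulmx P)) : Q *m z = 2 *: w.
  by apply/matrixP => i j; rewrite ord1 [RHS]mxE [w _ _]mxE mulrC divzK.
rewrite mulmxA PQ mul_scalar_mx -scalemxAr => /matrixP e; apply/matrixP => i j.
by have := e i j; rewrite [LHS]mxE [RHS]mxE => /mulfI ->.
Qed.

Lemma lattice_Z3E : lattice_Z3 R = zspan 1%:M.
Proof. by apply: eq_imagel => z _; rewrite mul1mx. Qed.

Lemma lattice_DTE : lattice_DT R = zspan (mxint basis_DT).
Proof.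
rewrite (zspan_congruence basis_DT_D basis_D_DT) /lattice_DT; congr image.
apply/seteqP; split=> z /=.
  move=> + i; elim/ord3_ind: i; rewrite mxE sum3 !mxE !entry3E;
    by move: (z 0 0) (z 1 0) (z 2 0) => x y w []; lia.
move=> h; move: (h 0) (h 1) (h 2); rewrite !mxE !sum3 !mxE !entry3E.
by move: (z 0 0) (z 1 0) (z 2 0) => x y w; split; lia.
Qed.

Lemma lattice_DE : lattice_D R = zspan (mxint basis_D).
Proof.
rewrite (zspan_congruence basis_D_DT basis_DT_D) /lattice_D; congr image.
apply/seteqP; split=> z /=.
  move=> + i; elim/ord3_ind: i; rewrite mxE sum3 !mxE !entry3E;
    by move: (z 0 0) (z 1 0) (z 2 0) => x y w; lia.
move=> h; move: (h 0); rewrite !mxE !sum3 !mxE !entry3E.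
by move: (z 0 0) (z 1 0) (z 2 0) => x y w; lia.
Qed.

Lemma mxint_unit (P Q : 'M[int]_3) : P *m Q = 2%:M -> mxint P \in unitmx.
Proof.
move=> PQ; suff /mulmx1_unit[] : mxint P *m (2^-1 *: mxint Q) = 1%:M by [].
rewrite -scalemxAr -map_mxM PQ map_scalar_mx scale_scalar_mx mulVf //.
by rewrite pnatr_eq0.
Qed.

Lemma gram_Z3 : (1%:M : 'M[R]_3)^T *m 1%:M = 1 *: gram3 0 0 0.
Proof. by rewrite scale1r trmx1 mulmx1; mx3_compute. Qed.

Lemma gram_DT : (mxint basis_DT)^T *m mxint basis_DT =
  3 *: gram3 (- (1 / 3)) (- (1 / 3)) (- (1 / 3)).
Proof. mx3_compute; rewrite ?mulrNz ?mulr1z; lra. Qed.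

Lemma gram_D : (mxint basis_D)^T *m mxint basis_D =
  2 *: gram3 (1 / 2) (1 / 2) (1 / 2).
Proof. mx3_compute; rewrite ?mulr0z ?mulr1z; lra. Qed.

(** If [v0] has inner product -1/2 with the orthogonal vectors [v1] and [v2],
    then [v1], [v0 + v1], [v0 + v1 + v2] are unit vectors with all inner
    products 1/2. The other two cases follow by renumbering. *)
Lemma fcc_basis_change (a b c : R) :
  [\/ (a = 0 /\ b = - (1 / 2) /\ c = - (1 / 2)) ,
      (a = - (1 / 2) /\ b = 0 /\ c = - (1 / 2)) |
      (a = - (1 / 2) /\ b = - (1 / 2) /\ c = 0)] ->
  exists U V : 'M[int]_3, U *m V = 1%:M /\
    (mxint U)^T *m gram3 a b c *m mxint U = gram3 (1 / 2) (1 / 2) (1 / 2).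
Proof.
case=> -[-> [-> ->]].
- exists (mx3 (0, 1, 1) (1, 1, 1) (0, 0, 1)), (mx3 (-1, 1, 0) (1, 0, -1) (0, 0, 1)).
  split; mx3_compute => //; rewrite ?sum3 ?mxE ?entry3E ?mulr0z ?mulr1z; lra.
- exists (mx3 (1, 1, 1) (0, 1, 1) (0, 0, 1)), (mx3 (1, -1, 0) (0, 1, -1) (0, 0, 1)).
  split; mx3_compute => //; rewrite ?sum3 ?mxE ?entry3E ?mulr0z ?mulr1z; lra.
- exists (mx3 (0, 0, 1) (1, 1, 1) (0, 1, 1)), (mx3 (0, 1, -1) (-1, 0, 1) (1, 0, 0)).
  split; mx3_compute => //; rewrite ?sum3 ?mxE ?entry3E ?mulr0z ?mulr1z; lra.
Qed.

End Models.

(** * Symmetric lattices are similar to cubic ones *)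

Section SimilarToModel.
Variable R : realType.

Lemma zspan_similar_gram (B M G : 'M[R]_3) (s k : R) : 0 < s -> 0 < k ->
  B \in unitmx -> M \in unitmx -> B^T *m B = s ^+ 2 *: G -> M^T *m M = k *: G ->
  exists (c : R) (g : 'M[R]_3),
    [/\ 0 < c, orthogonal_group g & [set c *: (g *m x) | x in zspan B] = zspan M].
Proof.
move=> s0 k0 uB uM BG MG; have c0 : 0 < Num.sqrt k / s by rewrite divr_gt0 ?sqrtr_gt0.
have [|g gO gL] := similar_zspan c0 uB uM; last by exists (Num.sqrt k / s), g.
rewrite BG MG scalerA exprMn exprVn sqr_sqrtr ?(ltW k0) // divfK //.
by rewrite expf_neq0 ?gt_eqF.
Qed.

Lemma symmetric_similar_model (L : set 'cV[R]_3) :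
  is_lattice L -> generates (min_vectors L) L -> irreducible_action (symmetry_group L) ->
  exists (c : R) (g : 'M[R]_3),
    [/\ 0 < c, orthogonal_group g &
        let cgL := [set c *: (g *m x) | x in L] in
        [\/ cgL = lattice_Z3 R, cgL = lattice_DT R | cgL = lattice_D R]].
Proof.
move=> LL gL irr; have m0 := @min_norm_gt0 R 3 L isT LL gL.
have sL := lattice_additive LL.
have [B [a [b [c [FB g sgn]]]]] := reduced_frame LL gL m0.
rewrite (@frame_zspan _ _ _ _ _ sL FB) // lattice_Z3E lattice_DTE lattice_DE.
have [uB KB] := FB; have uD := mxint_unit R basis_D_DT; have uDT := mxint_unit R basis_DT_D.
case: (frame_form_classes LL gL irr FB g sgn) => [h|h|h|h].
- case: h g => -> [-> ->] g.
  have [k [h [k0 hO e]]] := zspan_similar_gram m0 ltr01 uB (unitmx1 _ _) g (gram_Z3 R).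
  by exists k, h; split => //; constructor 1.
- case: h g => -> [-> ->] g.
  have [k [h [k0 hO e]]] := zspan_similar_gram m0 (ltr0n _ 3) uB uDT g (gram_DT R).
  by exists k, h; split => //; constructor 2.
- case: h g => -> [-> ->] g.
  have [k [h [k0 hO e]]] := zspan_similar_gram m0 (ltr0n _ 2) uB uD g (gram_D R).
  by exists k, h; split => //; constructor 3.
have [U [V [UV UG]]] := fcc_basis_change h.
have uBU : B *m mxint R U \in unitmx.
  rewrite unitmx_mul uB; suff /mulmx1_unit[] : mxint R U *m mxint R V = 1%:M by [].
  by rewrite -map_mxM UV map_mx1.
have gU : (B *m mxint R U)^T *m (B *m mxint R U) =
    min_norm L ^+ 2 *: gram3 (1 / 2) (1 / 2) (1 / 2).
  by rewrite trmx_mul -mulmxA (mulmxA B^T) g -scalemxAl -scalemxAr mulmxA UG.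
have [k [f [k0 fO e]]] := zspan_similar_gram m0 (ltr0n _ 2) uBU uD gU (gram_D R).
exists k, f; split => //; constructor 3.
by rewrite -e (zspan_unimodular _ UV).
Qed.

End SimilarToModel.

(** * Invariance under similarity *)

Section Transport.
Variables (R : realType) (d : nat) (s : R) (g : 'M[R]_d).
Hypotheses (s_gt0 : 0 < s) (gO : orthogonal_group g).
Let f (x : 'cV[R]_d) := s *: (g *m x).
Let f' (x : 'cV[R]_d) := s^-1 *: (g^T *m x).

Let fK : cancel f f'.
Proof.
move=> x; rewrite /f /f' -scalemxAr mulmxA (orthogonal_trmxK gO) mul1mx scalerA.
by rewrite mulVf ?gt_eqF // scale1r.
Qed.

Let f'K : cancel f' f.
Proof.
move=> x; rewrite /f /f' -scalemxAr mulmxA.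
have -> : g *m g^T = 1%:M by exact: gO.
by rewrite mul1mx scalerA mulfV ?gt_eqF // scale1r.
Qed.

Let enorm_f x : enorm (f x) = s * enorm x.
Proof.
rewrite !enormE dotZl dotZr dot_orthogonal // mulrA -expr2.
by rewrite sqrtrM ?sqr_ge0 // sqrtr_sqr ger0_norm // ltW.
Qed.

Let fB x y : f (x - y) = f x - f y.
Proof. by rewrite /f mulmxBr scalerBr. Qed.

Let f0 : f 0 = 0. Proof. by rewrite /f mulmx0 scaler0. Qed.

(** The symmetry group of the image is the conjugate by [g] of the symmetry
    group, and the similarity carries minimal vectors to minimal vectors. *)
Lemma orthogonally_symmetric_similar (L : set 'cV[R]_d) : (0 < d)%N ->
  orthogonally_symmetric L -> orthogonally_symmetric [set s *: (g *m x) | x in L].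
Proof.
move=> d0 [LL gL tL irr]; rewrite -/f; set L' := [set f x | x in L].
have m0 := min_norm_gt0 d0 LL gL.
have [B0 [_ /(_ (Ordinal d0)) [Lx0 x0m]]] := frame_ex LL gL; set x0 := col _ _ in Lx0 x0m.
have LE x : L' (f x) <-> L x.
  by split=> [[y Ly /(can_inj fK) <-]|Lx] //; exists x.
have m'E : min_norm L' = s * min_norm L.
  rewrite -x0m -enorm_f; apply: min_norm_attained; first by exists x0.
    by rewrite -enorm_gt0 enorm_f mulr_gt0 // x0m.
  move=> _ [y Ly <-] fy0; rewrite !enorm_f ler_pM2l // x0m min_norm_le //.
  by apply: contra_neq fy0 => ->.
have KE x : min_vectors L' (f x) <-> min_vectors L x.
  rewrite /min_vectors /= m'E enorm_f; split=> -[/LE Lx].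
    by move/(mulfI (lt0r_neq0 s_gt0)).
  by move->.
have sL := lattice_additive LL.
have sL' : additive_subgroup L'.
  split=> [|_ _ [x Lx <-] [y Ly <-]]; first by exists 0; [exact: sL.1|].
  by exists (x - y); [exact: sL.2|].
have GL h : symmetry_group L h -> symmetry_group L' (g *m h *m g^T).
  move=> [hO hL]; split.
    rewrite /orthogonal_group /= !trmx_mul trmxK !mulmxA -(mulmxA _ g^T) orthogonal_trmxK //.
    rewrite mulmx1 -(mulmxA g).
    by have -> : h *m h^T = 1%:M by [exact: hO]; rewrite mulmx1.
  have hf x : (g *m h *m g^T) *m f x = f (h *m x).
    by rewrite /f -scalemxAr -!mulmxA (mulmxA g^T) orthogonal_trmxK // mul1mx.
  apply/seteqP; split=> [_ [_ [x Lx <-] <-]|_ [x Lx <-]].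
    by rewrite hf; apply/LE; rewrite -hL; exists x.
  by move: Lx; rewrite -{1}hL => -[y Ly <-]; exists (f y); [exact/LE|].
split.
- have [B uB LB] := (is_latticeP L).1 LL; apply/is_latticeP; rewrite /L' LB.
  exists (s *: (g *m B)).
    by rewrite unitmxZ ?unitfE ?gt_eqF // unitmx_mul orthogonal_unit.
  apply/seteqP; split=> [_ [_ [z _ <-] <-]|_ [z _ <-]].
    by exists z => //; rewrite /f -scalemxAl mulmxA.
  by exists (B *m map_mx intr z); [exists z|rewrite /f -scalemxAl mulmxA].
- apply/seteqP; split.
    by apply: smallest_sub => // x [].
  move=> _ [x Lx <-] A /= [sA KA].
  apply: (generates_sub gL (A := [set y | A (f y)])) Lx => [|y Ky].
    by split=> [|y z]; rewrite /= ?f0 ?fB; [exact: sA.1|exact: sA.2].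
  by apply: KA; apply/KE.
- move=> x y; rewrite -[x]f'K -[y]f'K => /KE Kx /KE Ky.
  have [h hG hx] := tL _ _ Kx Ky; exists (g *m h *m g^T); first exact: GL.
  by rewrite -hx /f -scalemxAr -!mulmxA (mulmxA g^T) orthogonal_trmxK // mul1mx.
move=> V GV; pose W := (linfun (mulmx g : 'cV[R]_d -> 'cV[R]_d) @^-1: V)%VS.
have WE x : (x \in W) = (g *m x \in V) by rewrite -memv_preim lfunE.
have gg x : g *m (g^T *m x) = x.
  by rewrite mulmxA; have -> : g *m g^T = 1%:M by [exact: gO]; rewrite mul1mx.
have [h hG x|W0|WT] := irr W.
- rewrite !WE => /(GV _ (GL _ hG)).
  by rewrite -!mulmxA (mulmxA g^T) orthogonal_trmxK // mul1mx.
- left; apply/eqP; rewrite -subv0; apply/subvP => x; rewrite -[x]gg -WE W0 !memv0.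
  by move/eqP->; rewrite mulmx0.
right; apply/eqP; rewrite eqEsubv subvf; apply/subvP => x _.
by rewrite -[x]gg -WE WT memvf.
Qed.

End Transport.

(** * Symmetry of the cubic lattices *)

Section SignedPermutations.
Variables (R : realType) (d : nat).
Implicit Types (p : 'S_d) (e : {ffun 'I_d -> bool}).

Definition signed_perm_act (A : pzRingType) p e (x : 'cV[A]_d) : 'cV[A]_d :=
  \col_i ((-1) ^+ e i * x (p i) 0).

Definition signed_perm p e : 'M[R]_d := \matrix_(i, j) ((-1) ^+ e i * (j == p i)%:R).

Lemma signed_permE p e x : signed_perm p e *m x = signed_perm_act p e x.
Proof.
apply/matrixP => i j; rewrite ord1 !mxE (bigD1 (p i)) //= !mxE eqxx mulr1.
rewrite big1 ?addr0 // => k /negbTE kp; by rewrite mxE kp mulr0 mul0r.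
Qed.

Lemma signed_perm_orthogonal p e : orthogonal_group (signed_perm p e).
Proof.
apply/matrixP => i j; rewrite !mxE (bigD1 (p i)) //= !mxE eqxx mulr1 big1 ?addr0.
  rewrite (inj_eq perm_inj); have [->|] := eqVneq i j; last by rewrite !mulr0.
  by rewrite mulr1 -expr2 sqrr_sign.
by move=> k /negbTE kp; rewrite !mxE kp mulr0 mul0r.
Qed.

Lemma signed_perm_actK (A : pzRingType) p e :
  cancel (@signed_perm_act A p^-1%g [ffun i => e ((p^-1)%g i)]) (signed_perm_act p e).
Proof.
move=> x; apply/matrixP => i j; rewrite ord1 !mxE ffunE permK mulrA.
by rewrite -expr2 sqrr_sign mul1r.
Qed.

(** If the vector [x] of an invariant subspace has [x_i != 0], subtracting the
    image of [x] under the reflection in the [i]-th coordinate leaves a nonzero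
    multiple of the [i]-th basis vector, whose permutations span everything. *)
Lemma signed_perm_irreducible (G : set 'M[R]_d) :
  (forall p e, G (signed_perm p e)) -> irreducible_action G.
Proof.
move=> GS V GV; have [->|Vn] := eqVneq V 0%VS; [by left|right].
have [x xV x0] : exists2 x, x \in V & x != 0.
  by exists (vpick V); [exact: memv_pick|rewrite vpick0].
have [i xi] : exists i, x i 0 != 0.
  apply: contrapT => h; case/eqP: x0; apply/matrixP => i j; rewrite ord1 [RHS]mxE.
  by apply/eqP/negPn/negP => xi; apply: h; exists i.
have VS p e y : y \in V -> signed_perm_act p e y \in V.
  by rewrite -signed_permE; apply: GV.
have eiV : delta_mx i 0 \in V.
  (* [y] is [x] minus its reflection, that is [2 x_i] times the basis vector. *)
  pose y := x - signed_perm_act 1%g [ffun k => k == i] x.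
  have -> : delta_mx i 0 = (2 * x i 0)^-1 *: y.
    apply/matrixP => k j; rewrite ord1 !mxE ffunE perm1.
    have [->|ki] := eqVneq k i; last by rewrite expr0 mul1r subrr mulr0.
    rewrite expr1 mulN1r opprK -mulr2n -[x i 0 *+ 2]mulr_natl mulVf ?eqxx //.
    by rewrite mulf_neq0 // pnatr_eq0.
  by rewrite memvZ // rpredB // VS.
apply/eqP; rewrite eqEsubv subvf; apply/subvP => y _.
rewrite -[y]mul1mx mulmx_sum_cols rpred_sum // => j _; rewrite memvZ //.
have -> : col j 1%:M = signed_perm_act (tperm i j) [ffun=> false] (delta_mx i 0) :> 'cV[R]_d.
  apply/matrixP => k l; rewrite ord1 !mxE ffunE mul1r andbT.
  by rewrite (can2_eq (tpermK i j) (tpermK i j)) tpermL.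
exact: VS.
Qed.

(** Equal sums of squares mean equally many nonzero entries, so some permutation
    matches the supports; on the support the entries differ by a sign. *)
Lemma signed_perm_transitive (x y : 'cV[int]_d) :
  (forall i, x i 0 \in [:: 0; 1; -1]) -> (forall i, y i 0 \in [:: 0; 1; -1]) ->
  \sum_i x i 0 ^+ 2 = \sum_i y i 0 ^+ 2 -> exists p e, signed_perm_act p e x = y.
Proof.
move=> xU yU xy; pose t (z : 'cV[int]_d) := [tuple z i 0 != 0 | i < d].
have cnt (z : 'cV[int]_d) : (forall i, z i 0 \in [:: 0; 1; -1]) ->
    (count id (t z))%:Z = \sum_i z i 0 ^+ 2.
  move=> zU; rewrite -sum1_count big_map big_mkcond big_enum /=.
  rewrite (big_morph Posz PoszD (erefl 0%:Z)); apply: eq_bigr => i _.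
  by have := zU i; rewrite !inE => /or3P[] /eqP ->.
have /tuple_permP[p tp] : perm_eq (t y) (t x).
  apply/allP => b _ /=.
  have e : count id (t y) = count id (t x) by apply/eqP; rewrite -eqz_nat !cnt // xy.
  case: b; first by rewrite !(eq_count (_ : pred1 true =1 id)) ?e //; case.
  rewrite !(eq_count (_ : pred1 false =1 predC id)); try by case.
  by rewrite -(eqn_add2l (count id (t x))) -{1}e !count_predC !size_tuple.
exists p, [ffun i => y i 0 != x (p i) 0]; apply/matrixP => i j; rewrite ord1 !mxE ffunE.
have : (y i 0 != 0) = (x (p i) 0 != 0).
  have : tnth (t y) i = tnth (t x) (p i).
    by rewrite (tnth_nth false) tp -tnth_nth tnth_mktuple.
  by rewrite !tnth_mktuple.
move: (xU (p i)) (yU i); rewrite !inE.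
by do 2 (case/or3P => /eqP ->).
Qed.

End SignedPermutations.

Section Cubic.
Variables (R : realType) (d : nat).

Definition sqnorm (z : 'cV[int]_d) : int := \sum_i z i 0 ^+ 2.

Lemma dot_intr (z : 'cV[int]_d) :
  dot (map_mx intr z) (map_mx intr z) = (sqnorm z)%:~R :> R.
Proof.
by rewrite dotE rmorph_sum; apply: eq_bigr => i _; rewrite !mxE -intrM expr2.
Qed.

Lemma sqnorm_small z : sqnorm z <= 3 -> forall i, z i 0 \in [:: 0; 1; -1].
Proof.
move=> z3 i; have : z i 0 ^+ 2 <= 3.
  apply: le_trans z3; rewrite /sqnorm (bigD1 i) //= lerDl.
  by apply: sumr_ge0 => j _; exact: sqr_ge0.
rewrite !inE; move: (z i 0) => x; nia.
Qed.

(** The bound [k <= 3] ensures that an integer vector of squared length [k] has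
    entries 0, 1, -1 only, so that [signed_perm_transitive] applies to the minimal
    vectors; they generate because the columns of [P] are among them. *)
Lemma cubic_orthogonally_symmetric (Q : set 'cV[int]_d) (P : 'M[int]_d) (k : int) :
  (0 < d)%N -> k <= 3 ->
  (forall z, Q z -> z != 0 -> k <= sqnorm z) ->
  (forall p e z, Q z -> Q (signed_perm_act p e z)) ->
  (forall i, sqnorm (col i P) = k) ->
  (map_mx intr P : 'M[R]_d) \in unitmx ->
  [set map_mx intr z | z in Q] = zspan (map_mx intr P : 'M[R]_d) ->
  orthogonally_symmetric ([set map_mx intr z | z in Q] : set 'cV[R]_d).
Proof.
move=> d0 k3 Qmin QS Pk uP QE; set L := image _ _ in QE *.
have intr_inj : injective (map_mx intr : 'cV[int]_d -> 'cV[R]_d).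
  move=> z t /matrixP e; apply/matrixP => i j.
  by have /eqP := e i j; rewrite !mxE eqr_int => /eqP.
have LE z : L (map_mx intr z) <-> Q z.
  by split=> [[t Qt /intr_inj <-]|Qz] //; exists z.
have colP i : col i (map_mx intr P) = map_mx intr (col i P) :> 'cV[R]_d.
  by apply/matrixP => a b; rewrite !mxE.
have LP i : L (map_mx intr (col i P)).
  rewrite QE; exists (delta_mx i 0) => //; rewrite -colP [RHS]colE; congr (_ *m _).
  by apply/matrixP => a b; rewrite !mxE; case: (_ && _).
have Pneq0 i : map_mx intr (col i P) != 0 :> 'cV[R]_d.
  apply: contraTneq uP => Pi0; apply/negP => uP.
  have /(unitmx_inj uP) : map_mx intr P *m delta_mx i 0 = map_mx intr P *m (0 : 'cV[R]_d).
    by rewrite -[LHS]colE colP Pi0 mulmx0.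
  by move/matrixP/(_ i 0)/eqP; rewrite !mxE !eqxx oner_eq0.
have mE i : min_norm L = enorm (map_mx intr (col i P) : 'cV[R]_d).
  apply: min_norm_attained => // _ [z Qz <-] z0.
  rewrite ler_enorm !dot_intr ler_int Pk; apply: Qmin => //.
  by apply: contra_neq z0 => ->; rewrite map_mx0.
pose i0 := Ordinal d0.
have KE z : min_vectors L (map_mx intr z) <-> Q z /\ sqnorm z = k.
  split=> [[/LE Qz]|[Qz zk]]; last split; first last.
  - by rewrite (mE i0); apply/enorm_eqP; rewrite !dot_intr zk Pk.
  - exact/LE.
  rewrite (mE i0) => /enorm_eqP; rewrite !dot_intr Pk => /eqP.
  by rewrite eqr_int => /eqP.
have sL : additive_subgroup L by rewrite QE; exact: zspan_additive.
have act p e z : signed_perm R p e *m map_mx intr z = map_mx intr (signed_perm_act p e z).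
  rewrite signed_permE; apply/matrixP => i j; rewrite !mxE.
  by rewrite intrM rmorphXn rmorphN1.
have GS p e : symmetry_group L (signed_perm R p e).
  split; first exact: signed_perm_orthogonal.
  apply/seteqP; split=> [_ [_ [z Qz <-] <-]|_ [z Qz <-]].
    by rewrite act; apply/LE/QS.
  pose t := signed_perm_act p^-1%g [ffun i => e ((p^-1)%g i)] z.
  by exists (map_mx intr t); [apply/LE/QS|rewrite act signed_perm_actK].
split.
- by apply/is_latticeP; exists (map_mx intr P).
- apply/seteqP; split; first by apply: smallest_sub => // x [].
  rewrite {1}QE => x Lx A /= [sA KA]; apply: zspan_sub Lx => // i.
  by apply: KA; rewrite colP; apply/KE; split; [apply/LE|].
- move=> x y Kx Ky; have [z _ zx] := Kx.1; have [t _ ty] := Ky.1.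
  move: Kx Ky; rewrite -zx -ty => /KE[Qz zk] /KE[Qt tk].
  have [||//|p [e <-]] := @signed_perm_transitive d z t.
  - by apply: sqnorm_small; rewrite zk.
  - by apply: sqnorm_small; rewrite tk.
  - by rewrite -/(sqnorm z) zk -tk.
  by exists (signed_perm R p e).
exact: signed_perm_irreducible.
Qed.

End Cubic.

Section Models.
Variable R : realType.

(** The congruences defining the cubic lattices do not see signs. *)
Lemma parity_sign (b : bool) (x : int) : exists y, (-1) ^+ b * x = x + 2 * y.
Proof. by case: b; [exists (- x)|exists 0]; rewrite ?expr1 ?expr0; lia. Qed.

Lemma sqnorm3 (z : 'cV[int]_3) : sqnorm z = z 0 0 ^+ 2 + z 1 0 ^+ 2 + z 2 0 ^+ 2.
Proof. by rewrite /sqnorm sum3. Qed.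

(** These bounds turn the estimates of sums of squares below into linear
    arithmetic: [|x| <= x^2] combines with the parity conditions, and the last two
    handle vectors with all entries even. *)
Lemma int_sqr_bounds (x : int) :
  [/\ x <= x ^+ 2, - x <= x ^+ 2, 2 <= x -> 4 <= x ^+ 2 & x <= - 2 -> 4 <= x ^+ 2].
Proof. by split; nia. Qed.

Lemma cV3_neq0 (z : 'cV[int]_3) : z != 0 -> [|| z 0 0 != 0, z 1 0 != 0 | z 2 0 != 0].
Proof.
apply: contraNT; rewrite !negb_or !negbK => /and3P[/eqP z0 /eqP z1 /eqP z2].
by apply/eqP/matrixP => i j; rewrite ord1 [RHS]mxE; elim/ord3_ind: i.
Qed.

Lemma Z3_orthogonally_symmetric : orthogonally_symmetric (lattice_Z3 R).
Proof.
apply: (@cubic_orthogonally_symmetric R 3 setT 1%:M 1) => //.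
- move=> z _ /cV3_neq0; rewrite sqnorm3.
  have := int_sqr_bounds (z 0 0); have := int_sqr_bounds (z 1 0).
  have := int_sqr_bounds (z 2 0); move: (z 0 0) (z 1 0) (z 2 0) => x y w.
  move: (x ^+ 2) (y ^+ 2) (w ^+ 2) => x2 y2 w2 [? ? ? ?] [? ? ? ?] [? ? ? ?]; lia.
- by move=> i; rewrite sqnorm3 !mxE; elim/ord3_ind: i.
- by rewrite map_mx1 unitmx1.
by rewrite map_mx1 -lattice_Z3E.
Qed.

(** Nonzero vectors have squared length at least the sum of the absolute values of
    their entries, which is even and nonzero. *)
Lemma D_orthogonally_symmetric : orthogonally_symmetric (lattice_D R).
Proof.
apply: (@cubic_orthogonally_symmetric R 3 _ basis_D 2) => //.
- move=> z /= zD /cV3_neq0; rewrite sqnorm3; move: zD.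
  have := int_sqr_bounds (z 0 0); have := int_sqr_bounds (z 1 0).
  have := int_sqr_bounds (z 2 0); move: (z 0 0) (z 1 0) (z 2 0) => x y w.
  move: (x ^+ 2) (y ^+ 2) (w ^+ 2) => x2 y2 w2 [? ? ? ?] [? ? ? ?] [? ? ? ?]; lia.
- move=> p e z /=; rewrite -(sum3 (fun i => z i 0)) (reindex_perm p) sum3 /= !mxE.
  have [a ->] := parity_sign (e 0) (z (p 0) 0).
  have [b ->] := parity_sign (e 1) (z (p 1) 0).
  have [c ->] := parity_sign (e 2) (z (p 2) 0).
  by move: (z (p 0) 0) (z (p 1) 0) (z (p 2) 0) => x y w; lia.
- by move=> i; rewrite sqnorm3 !mxE; elim/ord3_ind: i.
- exact: (mxint_unit R basis_D_DT).
exact: lattice_DE.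
Qed.

Lemma DT_pairs (z : 'cV[int]_3) :
  [/\ (2 %| (z 0 0 + z 1 0)%R)%Z, (2 %| (z 1 0 + z 2 0)%R)%Z
      & (2 %| (z 2 0 + z 0 0)%R)%Z] <-> forall i j, (2 %| (z i 0 + z j 0)%R)%Z.
Proof.
split=> [|h]; last by split.
move=> + i j; elim/ord3_ind: i; elim/ord3_ind: j;
  by move: (z 0 0) (z 1 0) (z 2 0) => x y w []; lia.
Qed.

(** The entries are all odd, or all even: a nonzero vector has squared length at
    least 3 in the first case and 4 in the second. *)
Lemma DT_orthogonally_symmetric : orthogonally_symmetric (lattice_DT R).
Proof.
apply: (@cubic_orthogonally_symmetric R 3 _ basis_DT 3) => //.
- move=> z /= zD /cV3_neq0; rewrite sqnorm3; case: zD.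
  have := int_sqr_bounds (z 0 0); have := int_sqr_bounds (z 1 0).
  have := int_sqr_bounds (z 2 0); move: (z 0 0) (z 1 0) (z 2 0) => x y w.
  move: (x ^+ 2) (y ^+ 2) (w ^+ 2) => x2 y2 w2 [? ? ? ?] [? ? ? ?] [? ? ? ?]; lia.
- move=> p e z /DT_pairs zP; apply/DT_pairs => i j; move: (zP (p i) (p j)); rewrite !mxE.
  have [a ->] := parity_sign (e i) (z (p i) 0).
  have [b ->] := parity_sign (e j) (z (p j) 0).
  by move: (z (p i) 0) (z (p j) 0) => x y; lia.
- by move=> i; rewrite sqnorm3 !mxE; elim/ord3_ind: i.
- exact: (mxint_unit R basis_DT_D).
exact: lattice_DTE.
Qed.

End Models.

(** * The classification *)

Theorem proposition1 (R : realType) (L : set 'cV[R]_3) :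
  orthogonally_symmetric L <->
  exists (c : R) (g : 'M[R]_3),
    [/\ 0 < c, orthogonal_group g &
        let cgL := [set c *: (g *m x) | x in L] in
        [\/ cgL = lattice_Z3 R, cgL = lattice_DT R | cgL = lattice_D R]].
Proof.
split=> [[LL gL _ irr]|[c [g [c0 gO h]]]]; first exact: symmetric_similar_model.
have gTO : orthogonal_group g^T by rewrite /orthogonal_group /= trmxK orthogonal_trmxK.
suff -> : L = [set c^-1 *: (g^T *m y) | y in [set c *: (g *m x) | x in L]].
  apply: orthogonally_symmetric_similar; rewrite ?invr_gt0 //.
  by case: h => ->; [exact: Z3_orthogonally_symmetric | exact: DT_orthogonally_symmetric
                    | exact: D_orthogonally_symmetric].
have gK x : c^-1 *: (g^T *m (c *: (g *m x))) = x.
  by rewrite -scalemxAr mulmxA orthogonal_trmxK // mul1mx scalerA mulVf ?gt_eqF // scale1r.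
apply/seteqP; split=> [x Lx|_ [_ [x Lx <-] <-]]; last by rewrite gK.
by exists (c *: (g *m x)); [exists x | rewrite gK].
Qed.
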